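(* A point $w^*\in\mathbb{R}^n$ is a global minimizer of $g$ if and only if $$\nabla g(w^* )=\left(\left(\frac12\|w^*\|^2-\nu\right)I+D\right)w^*-\psi=0$$ and $$\|w^*\|^2-2\nu+2\alpha_1\ge 0.$$
   Context: Let $n\ge 1$ be an integer, $\nu\in\mathbb{R}$, $\psi=(\psi_1,\dots,\psi_n)^T\in\mathbb{R}^n$, and $D=\mathrm{Diag}(\alpha_1,\dots,\alpha_n)$ a real diagonal matrix with $\alpha_1\le\alpha_2\le\dots\le\alpha_n$. The double well potential function is $g:\mathbb{R}^n\to\mathbb{R}$, $$g(w)=\frac12\left(\frac12\|w\|^2-\nu\right)^2+\frac12 w^TDw-\psi^Tw,$$ where $\|\cdot\|$ is the Euclidean norm. $I$ is the $n\times n$ identity matrix. *)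

(* Defs.v *)
From HB Require Import structures.
From mathcomp Require Import all_boot all_order all_algebra.
From mathcomp Require Import all_classical all_reals all_analysis.

Set Implicit Arguments.
Unset Strict Implicit.
Unset Printing Implicit Defensive.

Import Order.TTheory GRing.Theory Num.Theory.
Import numFieldNormedType.Exports.

Local Open Scope ring_scope.

(* The canonical norm `|w| on matrices is the sup norm, hence this definition.
   The two norms are equivalent, so differentiability is the usual one. *)
Definition enorm (R : realType) (n : nat) (w : 'cV[R]_n) : R :=
  Num.sqrt (\sum_(i < n) w i 0 ^+ 2).

Definition double_well (R : realType) (n : nat) (nu : R) (psi : 'cV[R]_n)
    (D : 'M[R]_n) (w : 'cV[R]_n) : R :=
  2^-1 * (2^-1 * enorm w ^+ 2 - nu) ^+ 2
  + 2^-1 * (w^T *m D *m w) 0 0 - (psi^T *m w) 0 0.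

(* Partial derivatives are total operators: this is the gradient only where
   f is differentiable. *)
Definition gradient (R : realType) (n : nat) (f : 'cV[R]_n -> R)
    (w : 'cV[R]_n) : 'cV[R]_n :=
  \col_(i < n) 'D_(delta_mx i 0) f w.

Definition global_minimizer (R : realType) (n : nat) (f : 'cV[R]_n -> R)
    (w : 'cV[R]_n) : Prop :=
  forall v : 'cV[R]_n, f w <= f v.

(* Main.v *)
(* With t = |w|^2/2 - nu and G = (t I + D) w - psi, the increment is exactly
   g(w + v) - g(w) = <G, v> + 1/2 <v, (t I + D) v> + 1/2 (<w, v> + |v|^2/2)^2.
   If G = 0 and t + alpha_1 >= 0, no term is negative.  Conversely, G = 0 at a
   minimizer, and the second condition follows from a single step along the
   first axis: the one that flips the sign of w_1 keeps |w|, so the last term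
   vanishes; when w_1 = 0 that term is quartic in the step. *)
Require Import Defs.
From HB Require Import structures.
From mathcomp Require Import all_boot all_order all_algebra.
From mathcomp Require Import all_classical all_reals all_analysis.
From mathcomp Require Import ring lra.
Import Order.TTheory GRing.Theory Num.Theory.
Import numFieldNormedType.Exports.
Local Open Scope ring_scope.

Lemma sqr_enorm (R : realType) (n : nat) (w : 'cV[R]_n) :
  enorm w ^+ 2 = \sum_(i < n) w i 0 ^+ 2.
Proof. by rewrite sqr_sqrtr // sumr_ge0 // => i _; rewrite sqr_ge0. Qed.

Lemma double_wellE (R : realType) (n : nat) (nu : R) (psi : 'cV[R]_n)
    (alpha : 'rV[R]_n) (w : 'cV[R]_n) :
  double_well nu psi (diag_mx alpha) w =
  2^-1 * (2^-1 * (\sum_(i < n) w i 0 ^+ 2) - nu) ^+ 2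
  + 2^-1 * (\sum_(i < n) alpha 0 i * w i 0 ^+ 2)
  - \sum_(i < n) psi i 0 * w i 0.
Proof.
rewrite /double_well sqr_enorm -mulmxA mul_diag_mx !mxE.
congr (_ + _ * _ - _); apply: eq_bigr => i _; rewrite !mxE //; ring.
Qed.

(** With s = <w, v> + |v|^2/2, the increment of |w|^2/2, the outer square grows by 2 t s + s^2. The
    part t s feeds the linear and quadratic terms, and s^2 stays apart as a square. *)
Lemma double_wellD (R : realType) (n : nat) (nu : R) (psi : 'cV[R]_n)
    (alpha : 'rV[R]_n) (w v : 'cV[R]_n) :
  let D := diag_mx alpha in
  let t := 2^-1 * enorm w ^+ 2 - nu in
  double_well nu psi D (v + w) = double_well nu psi D w
  + \sum_(i < n) ((t%:M + D) *m w - psi) i 0 * v i 0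
  + 2^-1 * (\sum_(i < n) (t + alpha 0 i) * v i 0 ^+ 2)
  + 2^-1 * (\sum_(i < n) w i 0 * v i 0 + 2^-1 * (\sum_(i < n) v i 0 ^+ 2)) ^+ 2.
Proof.
move=> D t; rewrite !double_wellE mulmxDl mul_scalar_mx mul_diag_mx.
(* All sums are split into a few basic ones, which [field] then treats as atoms. *)
have -> : \sum_(i < n) (t *: w + \matrix_(i, j) (alpha 0 i * w i j) - psi) i 0
    * v i 0 = t * (\sum_(i < n) w i 0 * v i 0)
    + (\sum_(i < n) alpha 0 i * (w i 0 * v i 0)) - \sum_(i < n) psi i 0 * v i 0.
  rewrite mulr_sumr -big_split -sumrB; apply: eq_bigr => i _ /=.
  by rewrite !mxE; ring.
have -> : \sum_(i < n) (t + alpha 0 i) * v i 0 ^+ 2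
    = t * (\sum_(i < n) v i 0 ^+ 2) + \sum_(i < n) alpha 0 i * v i 0 ^+ 2.
  by rewrite mulr_sumr -big_split; apply: eq_bigr => i _ /=; ring.
have -> : \sum_(i < n) (v + w) i 0 ^+ 2 = \sum_(i < n) v i 0 ^+ 2
    + 2 * (\sum_(i < n) w i 0 * v i 0) + \sum_(i < n) w i 0 ^+ 2.
  by rewrite mulr_sumr -!big_split; apply: eq_bigr => i _ /=; rewrite mxE; ring.
have -> : \sum_(i < n) alpha 0 i * (v + w) i 0 ^+ 2
    = \sum_(i < n) alpha 0 i * v i 0 ^+ 2
    + 2 * (\sum_(i < n) alpha 0 i * (w i 0 * v i 0))
    + \sum_(i < n) alpha 0 i * w i 0 ^+ 2.
  by rewrite mulr_sumr -!big_split; apply: eq_bigr => i _ /=; rewrite mxE; ring.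
have -> : \sum_(i < n) psi i 0 * (v + w) i 0
    = \sum_(i < n) psi i 0 * v i 0 + \sum_(i < n) psi i 0 * w i 0.
  by rewrite -!big_split; apply: eq_bigr => i _ /=; rewrite mxE; ring.
by rewrite /t sqr_enorm; field.
Qed.

Lemma double_well_axis (R : realType) (n : nat) (nu : R) (psi : 'cV[R]_n)
    (alpha : 'rV[R]_n) (w : 'cV[R]_n) (i : 'I_n) (h : R) :
  let D := diag_mx alpha in
  let t := 2^-1 * enorm w ^+ 2 - nu in
  double_well nu psi D (h *: delta_mx i 0 + w) = double_well nu psi D w
  + ((t%:M + D) *m w - psi) i 0 * h
  + 2^-1 * ((t + alpha 0 i) * h ^+ 2)
  + 2^-1 * (w i 0 * h + 2^-1 * h ^+ 2) ^+ 2.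
Proof.
move=> D t; rewrite double_wellD -/t.
(* The exponent is positive so that the zero coordinates contribute nothing; [k = 0] covers the
   linear sums, as [x ^+ 1] reduces to [x]. *)
have E (F : 'I_n -> R) k : \sum_(j < n)
    F j * (h *: delta_mx i 0 : 'cV[R]_n) j 0 ^+ k.+1 = F i * h ^+ k.+1.
  rewrite (bigD1 i) //= big1 => [|j /negPf ji].
    by rewrite !mxE !eqxx mulr1 addr0.
  by rewrite !mxE ji mulr0 expr0n mulr0.
have := E (fun j => ((t%:M + D) *m w - psi) j 0) 0%N.
have := E (fun j => w j 0) 0%N; have := E (fun j => t + alpha 0 j) 1%N.
have := E (fun=> 1) 1%N; rewrite /=.
under eq_bigr do rewrite mul1r.
by rewrite mul1r => -> -> -> ->.
Qed.

(** For [h != 0] the difference quotient is [p.[h]], and polynomials are continuous. *)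
Lemma derive_horner (R : realType) (V : normedModType R) (f : V -> R)
    (x v : V) (p : {poly R}) :
  (forall h : R, f (h *: v + x) = f x + h * p.[h]) -> 'D_v f x = p.[0].
Proof.
move=> fE; apply/cvg_lim => //.
apply: (@cvg_trans _ ((fun h : R => p.[h]) @ 0^')%classic); last first.
  by apply: cvg_within_filter; exact: continuous_horner.
apply: near_eq_cvg; near=> h.
have h0 : h != 0 by near: h; exact: nbhs_dnbhs_neq.
by rewrite /= fE addrAC subrr add0r [RHS]mulKf.
Unshelve. all: by end_near. Qed.

(** Fermat's rule for the restriction [phi] of [f] to the line through [w] along [v]. *)
Lemma derive_global_minimizer (R : realType) (n : nat)
    (f : 'cV[R]_n.+1 -> R) (w v : 'cV[R]_n.+1) :
  (forall x, differentiable f x) -> global_minimizer f w -> 'D_v f w = 0.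
Proof.
move=> df fmin; pose phi (h : R) := f (h *: v + w).
have dphi h : derivable phi h 1.
  apply/derivable1_diffP.
  by apply: (@differentiable_comp _ _ _ _ (fun h : R => h *: v + w) f).
have -> : 'D_v f w = 'D_1 phi 0.
  rewrite /derive; set q1 := fun h => _; set q2 := fun h => _.
  suff -> : q1 = q2 by [].
  apply/funext => h; rewrite /q1 /q2 /phi /=.
  by rewrite addr0 scale0r add0r [_%:A]mulr1.
have phi_min : is_derive (0 : R) 1 phi 0.
  (* Any open interval around 0 would do, the minimum being global. *)
  apply: (@derive1_at_min _ phi (-1) 1) => [|//||h _].
  - lra.
  - by rewrite in_itv /=; apply/andP; split; lra.
  - by rewrite /phi scale0r add0r.
exact: derive_val.
Qed.

Lemma differentiable_double_well (R : realType) (n : nat) (nu : R)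
    (psi : 'cV[R]_n.+1) (alpha : 'rV[R]_n.+1) (w : 'cV[R]_n.+1) :
  differentiable (double_well nu psi (diag_mx alpha)) w.
Proof.
(* Written as an algebraic combination of coordinate functions, the function falls under the closure
   rules for differentiability. *)
have -> : double_well nu psi (diag_mx alpha) =
  2^-1 *: (2^-1 *: (\sum_(i < n.+1) (fun w : 'cV[R]_n.+1 => w i 0) ^+ 2) - cst nu) ^+ 2
  + 2^-1 *: (\sum_(i < n.+1) alpha 0 i *: (fun w : 'cV[R]_n.+1 => w i 0) ^+ 2)
  - \sum_(i < n.+1) psi i 0 *: (fun w : 'cV[R]_n.+1 => w i 0).
  apply/funext => u; by rewrite double_wellE !fctE !fct_sumE.
have dX i : differentiable (fun w : 'cV[R]_n.+1 => w i 0) w.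
  exact: differentiable_coord.
apply: differentiableB; first apply: differentiableD.
- apply: differentiableZ; apply: differentiableX; apply: differentiableB => //.
  apply: differentiableZ; apply: differentiable_sum => i.
  exact: differentiableX.
- apply: differentiableZ; apply: differentiable_sum => i.
  by apply: differentiableZ; exact: differentiableX.
- by apply: differentiable_sum => i; exact: differentiableZ.
Qed.

(* The step [h = - 2 * a] cancels the square; when [a = 0] this step is trivial
   and [h = sqrt (- c)] is used instead. *)
Lemma axis_gap_ge0 (R : rcfType) (a c : R) :
  (forall h, 0 <= c * h ^+ 2 + (a * h + 2^-1 * h ^+ 2) ^+ 2) -> 0 <= c.
Proof.
move=> gap; rewrite leNgt; apply/negP => c_lt0.
have [a0|a_neq0] := eqVneq a 0.
  have := gap (Num.sqrt (- c)).
  rewrite a0 mul0r add0r sqr_sqrtr ?oppr_ge0 ?(ltW c_lt0) //.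
  (* The gap is now - c^2 + c^2/4, which is negative. *)
  have : 0 < c ^+ 2 by rewrite exprn_even_gt0 //= lt_eqF.
  clear gap; lra.
have a2_gt0 : 0 < a ^+ 2 by rewrite exprn_even_gt0.
have := gap (- 2 * a).
have -> : c * (- 2 * a) ^+ 2 + (a * (- 2 * a) + 2^-1 * (- 2 * a) ^+ 2) ^+ 2
    = 4 * (a ^+ 2 * c) by field.
by rewrite pmulr_rge0 // pmulr_rge0 // leNgt c_lt0.
Qed.

Theorem theorem3 (R : realType) (n : nat) (nu : R) (psi : 'cV[R]_n.+1)
    (alpha : 'rV[R]_n.+1)
    (alpha_sorted : forall i j : 'I_n.+1, (i <= j)%N -> alpha 0 i <= alpha 0 j)
    (w : 'cV[R]_n.+1) :
  let D := diag_mx alpha in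
  let g := double_well nu psi D in
  (differentiable g w /\
   gradient g w = ((2^-1 * enorm w ^+ 2 - nu)%:M + D) *m w - psi) /\
  (global_minimizer g w <->
   gradient g w = 0 /\ 0 <= enorm w ^+ 2 - 2 * nu + 2 * alpha 0 ord0).
Proof.
move=> D g.
have dg : differentiable g w by exact: differentiable_double_well.
set t := 2^-1 * enorm w ^+ 2 - nu; set G := (t%:M + D) *m w - psi.
have gradE : gradient g w = G.
  apply/colP => i; rewrite mxE.
  (* The polynomial is the increment in [double_well_axis] divided by [h]; its value at 0 is
     [G i 0]. *)
  rewrite (@derive_horner _ _ _ _ _ ((G i 0)%:P + 'X *
     ((2^-1 * (t + alpha 0 i))%:P + 2^-1 *: ((w i 0)%:P + 2^-1 *: 'X) ^+ 2))).
    by rewrite !hornerE.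
  move=> h; rewrite /g double_well_axis -/D -/t -/G.
  by rewrite !(hornerD, hornerM, hornerZ, hornerX, hornerC, horner_exp); ring.
have -> : enorm w ^+ 2 - 2 * nu + 2 * alpha 0 ord0 = 2 * (t + alpha 0 ord0).
  by rewrite /t; field.
rewrite pmulr_rge0 // gradE; split=> //; split=> [gmin|[G0 ta] v]; last first.
  rewrite -(subrK w v) /g double_wellD -/t -/G G0 big1 => [|i _]; last first.
    by rewrite mxE mul0r.
  rewrite addr0 -addrA lerDl addr_ge0 // mulr_ge0 // ?sqr_ge0 //.
  apply: sumr_ge0 => i _; rewrite mulr_ge0 ?sqr_ge0 //.
  (* The first diagonal entry is the smallest, so its bound covers every axis. *)
  by apply: le_trans ta _; rewrite lerD2l alpha_sorted.
have G0 : G = 0.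
  rewrite -gradE; apply/colP => i; rewrite !mxE.
  by apply: derive_global_minimizer => // x; exact: differentiable_double_well.
(* Once [G = 0], twice the increment along the first axis is the gap with a = w_1 and c = t +
   alpha_1. *)
split=> //; apply: (@axis_gap_ge0 _ (w ord0 0)) => h.
have := gmin (h *: delta_mx ord0 0 + w).
rewrite /g double_well_axis -/D -/t -/G G0 mxE mul0r addr0 -addrA lerDl.
by rewrite -mulrDr pmulr_rge0.
Qed.
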